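(* Let $\alpha>0$, $\beta>0$, let $n\ge0$ be an integer, and for $t>0$ let $D_n(t)=\det\left(\int_0^1 x^{i+j}e^{-t/x}x^{\alpha}(1-x)^{\beta}dx\right)_{i,j=0}^{n-1}$, $H_n(t)=t\frac{d}{dt}\ln D_n(t)$ and $\widetilde H_n:=H_n-n(n+\alpha+\beta)$. Then $$\begin{aligned}(t\widetilde H_n'')^2=&-4t(\widetilde H_n')^3+(\widetilde H_n')^2\left[4\widetilde H_n+(\alpha+2\beta+t)^2+4n(n+\alpha+\beta)-4\beta(\alpha+\beta)\right]\\&+2\widetilde H_n'\left[-(\alpha+2\beta+t)\widetilde H_n-2n\beta(n+\alpha+\beta)\right]+\widetilde H_n^2,\end{aligned}$$ and this is the Jimbo–Miwa–Okamoto $\sigma$-form of Painlevé V for $\sigma=\widetilde H_n$ with parameters $$\nu_0=0,\quad \nu_1=-(n+\alpha+\beta),\quad \nu_2=n,\quad \nu_3=-\beta.$$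
   Context: The Jimbo–Miwa–Okamoto $\sigma$-form of Painlevé V with parameters $\nu_0,\nu_1,\nu_2,\nu_3$ is the equation $$(t\sigma'')^2=\left[\sigma-t\sigma'+2(\sigma')^2+(\nu_0+\nu_1+\nu_2+\nu_3)\sigma'\right]^2-4(\nu_0+\sigma')(\nu_1+\sigma')(\nu_2+\sigma')(\nu_3+\sigma').$$ Here $'$ denotes $d/dt$. Convention: $D_0:=1$. *)

(* Defs.v *)
From HB Require Import structures.
From mathcomp Require Import all_boot all_order all_algebra.
From mathcomp Require Import all_classical all_reals all_analysis.
Set Implicit Arguments.
Unset Strict Implicit.
Unset Printing Implicit Defensive.
Import Order.TTheory GRing.Theory Num.Theory.
Import numFieldNormedType.Exports.
Local Open Scope classical_set_scope.
Local Open Scope ring_scope.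

Section Definitions.
Context {R : realType}.
Implicit Types (alpha beta t x : R) (n k : nat) (s : R -> R).

(* At x = 0 the total operations give t / 0 = 0 and 0 `^ alpha = 0 when
   alpha != 0, so for alpha > 0 this is the extension of the weight by 0. *)
Definition moment_integrand alpha beta t k x : R :=
  x ^+ k * expR (- (t / x)) * x `^ alpha * (1 - x) `^ beta.

Definition moment alpha beta t k : R :=
  \int[lebesgue_measure]_(x in `[0, 1]) moment_integrand alpha beta t k x.

(* The determinant of the empty matrix is 1, so hankel_det alpha beta 0 t = 1. *)
Definition hankel_det alpha beta n t : R :=
  \det (\matrix_(i < n, j < n) moment alpha beta t (i + j)).

Definition Hn alpha beta n t : R :=
  t * derive1 (fun u : R => ln (hankel_det alpha beta n u)) t.

Definition Htilde alpha beta n t : R :=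
  Hn alpha beta n t - n%:R * (n%:R + alpha + beta).

(* The Jimbo-Miwa-Okamoto sigma-form of Painleve V for s, at the point t. *)
Definition JMO_sigma_PV (nu0 nu1 nu2 nu3 : R) s t : Prop :=
  let s1 := derive1 s t in let s2 := derive1n 2 s t in
  (t * s2) ^+ 2 =
    (s t - t * s1 + 2 * s1 ^+ 2
       + (nu0 + nu1 + nu2 + nu3) * s1) ^+ 2
    - 4 * (nu0 + s1) * (nu1 + s1) * (nu2 + s1)
        * (nu3 + s1).

Definition Htilde_ode alpha beta n s t : Prop :=
  let s1 := derive1 s t in let s2 := derive1n 2 s t in
  (t * s2) ^+ 2 =
    - 4 * t * s1 ^+ 3
    + s1 ^+ 2 *
        (4 * s t + (alpha + 2 * beta + t) ^+ 2
         + 4 * n%:R * (n%:R + alpha + beta) - 4 * beta * (alpha + beta))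
    + 2 * s1 *
        (- (alpha + 2 * beta + t) * s t
         - 2 * n%:R * beta * (n%:R + alpha + beta))
    + s t ^+ 2.

End Definitions.

(* Main.v *)
Require Import Defs.
From HB Require Import structures.
From mathcomp Require Import all_boot all_order all_algebra.
From mathcomp Require Import perm ring lra zify.
From mathcomp Require Import all_classical all_reals all_analysis.
Set Implicit Arguments.
Unset Strict Implicit.
Unset Printing Implicit Defensive.
Import Order.TTheory GRing.Theory Num.Theory.
Import numFieldNormedType.Exports.
Local Open Scope classical_set_scope.
Local Open Scope ring_scope.

(* In the variable y = 1/x, and after reversing the order of rows and columns,
   D_n is the Hankel determinant of the moments of a weight w on (1, oo) with
   w'/w = - t - g/y + b/(y - 1), where g = 2n + a + b depends on n; since t
   enters through e^(-ty), d/dt maps the j-th moment mu_j to - mu_(j+1).  Let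
   P_k be the monic orthogonal polynomials, a_k and b_k their recurrence
   coefficients and s_k the subleading coefficient of P_k.  Then
   (ln D_n)' = s_n, s_n' = b_n and b_n' = b_n (a_(n-1) - a_n) (Toda).
   The Pearson equation of w yields (y^2 - y) v' = M(y) v for the vector
   v = (P_n, P_(n-1)), with M a 2 x 2 matrix of explicit polynomials.  At y = 0
   and y = 1 the left-hand side vanishes while v does not, so
   det M(0) = det M(1) = 0.  Eliminating a_n and a_(n-1) between these two
   equations and the Toda equations leaves the sigma-form. *)

(** * Linear functionals on polynomials given by a moment sequence *)

Section MomentFunctional.
Context {R : realFieldType}.
Implicit Types (mu : nat -> R) (p q : {poly R}).

Definition momfun mu p : R := \sum_(i < size p) p`_i * mu i.

Lemma momfunE mu p N : (size p <= N)%N -> momfun mu p = \sum_(i < N) p`_i * mu i.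
Proof.
move=> pN; rewrite /momfun (big_ord_widen N (fun i => p`_i * mu i) pN).
rewrite big_mkcond; apply: eq_bigr => i _; case: ltnP => // ip.
by rewrite nth_default ?mul0r.
Qed.

Fact momfun_is_linear mu : scalar (momfun mu).
Proof.
move=> a p q; pose N := maxn (size p) (size q).
rewrite (@momfunE _ (a *: p + q) N) ?(@momfunE _ p N) ?(@momfunE _ q N)
  ?leq_maxl ?leq_maxr//; last first.
  by rewrite (leq_trans (size_polyD _ _))// geq_max leq_maxr
    (leq_trans (size_scale_leq _ _)) ?leq_maxl.
rewrite mulr_sumr -big_split/=; apply: eq_bigr => i _.
by rewrite coefD coefZ mulrDl mulrA.
Qed.

HB.instance Definition _ mu := GRing.isLinear.Build R {poly R} R _ (momfun mu)
  (momfun_is_linear mu).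

Lemma momfunD mu p q : momfun mu (p + q) = momfun mu p + momfun mu q.
Proof. exact: linearD. Qed.

Lemma momfunB mu p q : momfun mu (p - q) = momfun mu p - momfun mu q.
Proof. exact: linearB. Qed.

Lemma momfunN mu p : momfun mu (- p) = - momfun mu p.
Proof. exact: linearN. Qed.

Lemma momfun0 mu : momfun mu 0 = 0.
Proof. exact: linear0. Qed.

Lemma momfunZ mu c p : momfun mu (c *: p) = c * momfun mu p.
Proof. exact: linearZ. Qed.

Lemma momfunXn mu n : momfun mu 'X^n = mu n.
Proof.
rewrite /momfun size_polyXn big_ord_recr/= big1 ?add0r ?coefXn ?eqxx ?mul1r//.
by move=> i _; rewrite coefXn ltn_eqF ?mul0r.
Qed.

(** As d/dt sends [mu i] to [- mu i.+1], this turns the t-derivative of the functional into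
    multiplication of the argument by -X. *)
Lemma momfun_shift mu p : momfun (fun i => mu i.+1) p = momfun mu ('X * p).
Proof.
rewrite (@momfunE _ ('X * p) (size p).+1); last first.
  by have [->|p0] := eqVneq p 0; rewrite ?mulr0 ?size_poly0 ?size_mulX// mulrC size_mulX.
rewrite big_ord_recl /momfun !coefXM/= mul0r add0r.
by apply: eq_bigr => i _; rewrite coefXM.
Qed.

End MomentFunctional.

(** * Monic orthogonal polynomials of a positive functional *)

Lemma size_sub_monic (R : nzRingType) (p q : {poly R}) k :
  (size q <= k.+1)%N -> size p = k.+1 -> p \is monic ->
  (size (q - q`_k *: p)%R <= k)%N.
Proof.
move=> sq sp /monicP mp; apply/leq_sizeP => j kj; rewrite coefB coefZ.
move: kj; rewrite leq_eqVlt => /orP[/eqP<-|kj].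
  by have := mp; rewrite lead_coefE sp/= => ->; rewrite mulr1 subrr.
by rewrite (nth_default _ (leq_trans sq kj)) [p`_j]nth_default ?sp// mulr0 subr0.
Qed.

Section OrthogonalPolynomials.
Context {R : realFieldType}.
Variable mu : nat -> R.
Local Notation L := (momfun mu).

(** The pair is (P_k, P_(k-1)) with P_(-1) = 0; at the first step the quotient by L(0) = 0 only
    multiplies 0. Defining P_k by its three-term recurrence lets differentiability in t propagate by
    induction on k. *)
Fixpoint opolys k : {poly R} * {poly R} :=
  if k is k'.+1 then
    let: (p, q) := opolys k' in
    (('X - (L ('X * (p * p)) / L (p * p))%:P) * p - (L (p * p) / L (q * q)) *: q, p)
  else (1, 0).

Definition opoly k := (opolys k).1.
Definition onorm k := L (opoly k * opoly k).
Definition oalpha k := L ('X * (opoly k * opoly k)) / onorm k.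
(** In the usual indexing this is b_(k+1), the coefficient of P_k in the expansion of X P_(k+1). *)
Definition obeta k := onorm k.+1 / onorm k.
Definition osub k := - \sum_(j < k) oalpha j.

Lemma opoly0 : opoly 0 = 1. Proof. by []. Qed.

Lemma opolys2 k : (opolys k.+1).2 = opoly k.
Proof. by rewrite /opoly /=; case: (opolys k). Qed.

Lemma opoly1 : opoly 1 = 'X - (oalpha 0)%:P.
Proof. by rewrite /oalpha /onorm opoly0 /opoly/= scaler0 subr0 !mulr1. Qed.

Lemma opolySS k :
  opoly k.+2 = ('X - (oalpha k.+1)%:P) * opoly k.+1 - obeta k *: opoly k.
Proof.
have E : opolys k.+1 = (opoly k.+1, opoly k).
  by rewrite -(opolys2 k) /opoly; case: (opolys k.+1).
pose f (pq : {poly R} * {poly R}) := let: (p, q) := pq in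
  ('X - (L ('X * (p * p)) / L (p * p))%:P) * p - (L (p * p) / L (q * q)) *: q.
have -> : opoly k.+2 = f (opolys k.+1).
  by rewrite {1}/opoly; change (opolys k.+2) with
    (let: (p, q) := opolys k.+1 in (f (p, q), p)); case: (opolys k.+1).
by rewrite E.
Qed.

Lemma opoly_size_monic k :
  [/\ size (opoly k) = k.+1, opoly k \is monic,
      size (opoly k.+1) = k.+2 & opoly k.+1 \is monic].
Proof.
elim: k => [|k [sk mk sk1 mk1]].
  rewrite opoly1 opoly0 size_poly1 monic1 size_XsubC monicXsubC.
  by split.
have sM : size (('X - (oalpha k.+1)%:P) * opoly k.+1) = k.+3.
  by rewrite size_mul ?polyXsubC_eq0 ?monic_neq0 ?monicXsubC// size_XsubC sk1.
have sN : (size (- (obeta k *: opoly k))%R < k.+3)%N.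
  by rewrite size_polyN (leq_ltn_trans (size_scale_leq _ _)) ?sk.
split=> //; rewrite opolySS; first by rewrite size_polyDl ?sM.
apply/monicP; rewrite lead_coefDl ?sM//.
by rewrite lead_coefM lead_coefXsubC mul1r; apply/monicP.
Qed.

Lemma size_opoly k : size (opoly k) = k.+1.
Proof. by have [] := opoly_size_monic k. Qed.

Lemma monic_opoly k : opoly k \is monic.
Proof. by have [] := opoly_size_monic k. Qed.

Lemma opoly_neq0 k : opoly k != 0.
Proof. exact: monic_neq0 (monic_opoly k). Qed.

Lemma opoly_lead k : (opoly k)`_k = 1.
Proof. by have /monicP := monic_opoly k; rewrite lead_coefE size_opoly. Qed.

Lemma opoly_sublead k : (opoly k.+1)`_k = osub k.+1.
Proof.
elim: k => [|k IH].
  by rewrite opoly1 coefB coefX coefC/= /osub big_ord1 sub0r.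
rewrite opolySS coefB coefZ mulrBl coefB coefXM coefCM/= IH opoly_lead.
rewrite (@nth_default _ _ (opoly k)) ?size_opoly// mulr0 subr0.
by rewrite mulr1 /osub [in RHS]big_ord_recr/= opprD.
Qed.

Lemma osubS k : osub k.+1 = osub k - oalpha k.
Proof. by rewrite /osub big_ord_recr opprD. Qed.

(** The two top coefficients are split off along P_(k+1) and P_k; the remainder has degree below k,
    hence is invisible to P_k once orthogonality is known. *)
Lemma opoly_expand k (q : {poly R}) : (size q <= k.+2)%N ->
  exists2 r : {poly R}, (size r <= k)%N & q = q`_k.+1 *: opoly k.+1
    + (q`_k - q`_k.+1 * osub k.+1) *: opoly k + r.
Proof.
move=> sq; pose q1 := q - q`_k.+1 *: opoly k.+1.
have s1 : (size q1 <= k.+1)%N.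
  exact: size_sub_monic (size_opoly _) (monic_opoly _).
have q1k : q1`_k = q`_k - q`_k.+1 * osub k.+1.
  by rewrite coefB coefZ opoly_sublead.
exists (q1 - q1`_k *: opoly k).
  exact: size_sub_monic (size_opoly _) (monic_opoly _).
by rewrite q1k /q1; ring.
Qed.

Hypothesis Lpos : forall p : {poly R}, p != 0 -> 0 < L (p * p).

Lemma onorm_gt0 k : 0 < onorm k.
Proof. exact/Lpos/opoly_neq0. Qed.

Lemma onorm_neq0 k : onorm k != 0.
Proof. by rewrite gt_eqF ?onorm_gt0. Qed.

Lemma onormS k : onorm k.+1 = obeta k * onorm k.
Proof. by rewrite /obeta divfK ?onorm_neq0. Qed.

Lemma oalphaM k : L ('X * (opoly k * opoly k)) = oalpha k * onorm k.
Proof. by rewrite /oalpha divfK ?onorm_neq0. Qed.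

(** Strong induction. For P_(k+2), expand q along P_(k+1), P_k and a remainder. The choice of
    [oalpha] kills the product with P_(k+1), that of [obeta] the product with P_k; for the remainder
    the recurrence moves X onto it and the induction hypothesis applies. *)
Lemma opoly_orth k (q : {poly R}) : (size q <= k)%N -> L (opoly k * q) = 0.
Proof.
elim/ltn_ind: k q => -[|[|k]] IH q sq.
- by move: sq; rewrite leqn0 size_poly_eq0 => /eqP->; rewrite mulr0 momfun0.
- rewrite (size1_polyC sq) mulrC mul_polyC momfunZ opoly1.
  have := oalphaM 0; rewrite /onorm opoly0 !mulr1 => e.
  by rewrite momfunB -[(oalpha 0)%:P]mulr1 mul_polyC momfunZ e subrr mulr0.
have [q2 s2 ->] := opoly_expand sq.
have e1 : L (opoly k.+1 * opoly k) = 0 by apply: IH => //; rewrite size_opoly.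
(* X P_k - P_(k+1) has degree at most k, so P_(k+1) is orthogonal to it. *)
have e2 : L (opoly k.+1 * ('X * opoly k)) = onorm k.+1.
  have sX : (size ('X * opoly k - opoly k.+1)%R <= k.+1)%N.
    have := @size_sub_monic _ (opoly k.+1) ('X * opoly k) k.+1.
    rewrite coefXM/= opoly_lead scale1r; apply; rewrite ?size_opoly ?monic_opoly//.
    by rewrite mulrC size_mulX ?opoly_neq0// size_opoly.
  rewrite -['X * _](subrK (opoly k.+1)) mulrDr momfunD IH// add0r//.
have e3 : L (opoly k.+2 * opoly k.+1) = 0.
  rewrite opolySS.
  have -> : (('X - (oalpha k.+1)%:P) * opoly k.+1 - obeta k *: opoly k)
     * opoly k.+1 = 'X * (opoly k.+1 * opoly k.+1)
     - oalpha k.+1 *: (opoly k.+1 * opoly k.+1) - obeta k *: (opoly k.+1 * opoly k).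
    by rewrite -!mul_polyC; ring.
  by rewrite !momfunB !momfunZ oalphaM e1 /onorm; ring.
have e4 : L (opoly k.+2 * opoly k) = 0.
  rewrite opolySS.
  have -> : (('X - (oalpha k.+1)%:P) * opoly k.+1 - obeta k *: opoly k)
     * opoly k = (opoly k.+1 * ('X * opoly k))
     - oalpha k.+1 *: (opoly k.+1 * opoly k) - obeta k *: (opoly k * opoly k).
    by rewrite -!mul_polyC; ring.
  by rewrite !momfunB !momfunZ e2 e1 onormS /onorm; ring.
have e5 : L (opoly k.+2 * q2) = 0.
  rewrite opolySS.
  have -> : (('X - (oalpha k.+1)%:P) * opoly k.+1 - obeta k *: opoly k)
     * q2 = (opoly k.+1 * ('X * q2))
     - oalpha k.+1 *: (opoly k.+1 * q2) - obeta k *: (opoly k * q2).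
    by rewrite -!mul_polyC; ring.
  rewrite !momfunB !momfunZ !IH ?mulr0 ?subr0//.
    exact: leqW.
  have [->|q0] := eqVneq q2 0; first by rewrite mulr0 size_poly0.
  by rewrite mulrC size_mulX.
by rewrite !mulrDr !momfunD -!scalerAr !momfunZ e3 e4 e5 !mulr0 !addr0.
Qed.

(** By orthogonality only the two top coefficients of q contribute. The pairings in the structure
    relations are all evaluated with this formula. *)
Lemma momfun_opoly k (q : {poly R}) : (size q <= k.+2)%N ->
  L (opoly k * q) = (q`_k - q`_k.+1 * osub k.+1) * onorm k.
Proof.
move=> sq; have [r sr {1}->] := opoly_expand sq.
rewrite !mulrDr !momfunD -!scalerAr !momfunZ (opoly_orth sr).
by rewrite (mulrC (opoly k) (opoly k.+1)) opoly_orth ?size_opoly// mulr0 add0r addr0.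
Qed.

(** Writing P_(k+1) = A (X - c) and P_k = B (X - c) gives P_k A = B P_(k+1). The functional is
    [onorm mu k] on the left, A being monic of degree k, and 0 on the right, B having degree below
    k+1. *)
Lemma opoly_no_common_root k c :
  root (opoly k.+1) c -> root (opoly k) c -> False.
Proof.
move=> /factor_theorem[A eA] /factor_theorem[B eB].
have A0 : A != 0.
  by apply/eqP => A0; have := opoly_neq0 k.+1; rewrite eA A0 mul0r eqxx.
have B0 : B != 0.
  by apply/eqP => B0; have := opoly_neq0 k; rewrite eB B0 mul0r eqxx.
have sA : size A = k.+1.
  have := size_opoly k.+1; rewrite eA size_Mmonic ?monicXsubC// size_XsubC addn2.
  by case.
have sB : size B = k.
  have := size_opoly k; rewrite eB size_Mmonic ?monicXsubC// size_XsubC addn2.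
  by case.
have Ak : A`_k = 1.
  have := monic_opoly k.+1; rewrite eA monicE lead_coefM lead_coefXsubC mulr1.
  by rewrite lead_coefE sA => /eqP.
have := @momfun_opoly k A; rewrite sA leqnSn Ak nth_default ?sA// => /(_ isT).
rewrite mul0r subr0 mul1r eB -mulrA (mulrC _ A) -eA mulrC opoly_orth ?sB; last exact/leqW.
by move/eqP; rewrite eq_sym (negbTE (onorm_neq0 k)).
Qed.

Lemma momfun_sq_eq0 p : L (p * p) = 0 -> p = 0.
Proof.
by move=> p0; apply/eqP; apply/negPn/negP => /Lpos; rewrite p0 ltxx.
Qed.

End OrthogonalPolynomials.

(** * Structure relations of a Pearson functional and the resulting sigma-form *)

Lemma coef_euler (R : comNzRingType) (p : {poly R}) j :
  ('X * p^`())`_j = j%:R * p`_j.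
Proof.
case: j => [|j]; first by rewrite coefXM/= mul0r.
by rewrite coefXM/= coef_deriv mulr_natl.
Qed.

Section StructureRelations.
Context {R : realFieldType}.
Variables (mu : nat -> R) (t g b : R).
Local Notation L := (momfun mu).
Hypothesis Lpos : forall p : {poly R}, p != 0 -> 0 < L (p * p).

(** This is ((y^2 - y) w)' / w for w'/w = - t - g/y + b/(y - 1). The hypothesis [pearson] below then
    says that the integral of ((y^2 - y) w p)' is zero. *)
Definition pearson_weight : {poly R} :=
  - t *: ('X * 'X) + (t + 2 - g + b) *: 'X + (g - 1)%:P.

Hypothesis pearson : forall p : {poly R},
  L (('X * 'X - 'X) * p^`() + pearson_weight * p) = 0.

Local Notation P := (opoly mu).
Local Notation n k := (k.+1%:R : R).

(** For n = k+1 these give the entries of M at the two singular points: at y = 0 the diagonal is -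
    X, X - g and the off-diagonal entries are b_n (U - t), - (V - t); at y = 1 the diagonal is n -
    X, X - n - b and the off-diagonal entries are b_n U, - V. *)
Definition structX k := n k + osub mu k.+1 + t * obeta mu k.
Definition structU k := t * oalpha mu k.+1 - 2 * n k - 1 + g - b.
Definition structV k := t * oalpha mu k - 2 * n k + 1 + g - b.
Local Notation X := structX.
Local Notation U := structU.
Local Notation V := structV.

Lemma coefX_opoly k : ('X * P k)`_k = osub mu k.
Proof.
by case: k => [|k]; rewrite coefXM//= ?opoly_sublead// /osub big_ord0 oppr0.
Qed.

(** Integration by parts: the Pearson identity applied to the product p q. *)
Lemma pearson_mul p q : L (('X * 'X - 'X) * p^`() * q) =
  - L (p * (('X * 'X - 'X) * q^`() + pearson_weight * q)).
Proof.
apply/eqP; rewrite -addr_eq0 -momfunD -[eqbRHS](pearson (p * q)) derivM.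
by apply/eqP; congr (momfun mu _); ring.
Qed.

(** First row of M. Comparing top coefficients shows that the difference r of the two sides has
    degree at most k; integration by parts and orthogonality then give L(r q) = 0 for every q of
    degree at most k, in particular for q = r. *)
Lemma structure_opolyS k : ('X * 'X - 'X) * (P k.+1)^`() =
  ((n k)%:P * 'X - (X k)%:P) * P k.+1
  + (obeta mu k)%:P * (t%:P * 'X + (U k - t)%:P) * P k.
Proof.
set Rm := RHS; apply/eqP; rewrite -subr_eq0; apply/eqP.
set r := _ - _; have sr : (size r <= k.+1)%N.
  apply/leq_sizeP => -[//|j]; rewrite ltnS => kj.
  have -> : r = 'X * ('X * (P k.+1)^`() - n k *: P k.+1 - (obeta mu k * t) *: P k)
     - 'X * (P k.+1)^`() + X k *: P k.+1 - (obeta mu k * (U k - t)) *: P k.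
    by rewrite /r /Rm -!mul_polyC !rmorphM/=; ring.
  rewrite !(coefB, coefD, coefZ) coefXM/= !(coefB, coefZ) !coef_euler.
  rewrite [(P k)`_j.+1]nth_default ?size_opoly ?ltnS//.
  move: kj; rewrite leq_eqVlt => /orP[/eqP<-|].
    by rewrite !opoly_sublead !opoly_lead /structX -!natr1; ring.
  rewrite leq_eqVlt => /orP[/eqP<-|kj].
    rewrite opoly_lead [(P k.+1)`_k.+2]nth_default ?size_opoly//.
    by rewrite [(P k)`_k.+1]nth_default ?size_opoly//; ring.
  by rewrite !nth_default ?size_opoly// ?(ltnW kj) ?(leqW kj)//; [ring|lia..].
(* Only the second factor of r r is generalized to q, which keeps the claim linear in the
   coefficients of q. *)
apply: (momfun_sq_eq0 Lpos); move: {-2}r sr => q sq.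
(* After integration by parts, [q1] collects what is paired with P_(k+1) and [q2] what is paired
   with P_k. *)
pose q1 := ('X * 'X - 'X) * q^`() + pearson_weight * q
   + ((n k)%:P * 'X - (X k)%:P) * q.
pose q2 := (obeta mu k)%:P * (t%:P * 'X + (U k - t)%:P) * q.
have -> : r * q = ('X * 'X - 'X) * (P k.+1)^`() * q
   - P k.+1 * (q1 - (('X * 'X - 'X) * q^`() + pearson_weight * q)) - P k * q2.
  by rewrite /r /Rm /q1 /q2; ring.
rewrite !mulrBr !momfunB pearson_mul.
have q1E : q1 = 'X * ('X * q^`() + (- t) *: ('X * q) + (t + 2 - g + b + n k) *: q)
   - 'X * q^`() + (g - 1 - X k) *: q.
  by rewrite /q1 /pearson_weight -!mul_polyC !(rmorphD, rmorphB, rmorphN)/=; ring.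
have q2E : q2 = 'X * ((obeta mu k * t) *: q) + (obeta mu k * (U k - t)) *: q.
  by rewrite /q2 -!mul_polyC !(rmorphD, rmorphB, rmorphM)/=; ring.
have q1c j : q1`_j.+1 = j%:R * q`_j - t * ('X * q)`_j + (t + 2 - g + b + n k) * q`_j
    - j.+1%:R * q`_j.+1 + (g - 1 - X k) * q`_j.+1.
  by rewrite q1E !(coefB, coefD, coefZ) coefXM/= !(coefD, coefZ) !coef_euler; ring.
have q2c j : q2`_j = obeta mu k * t * ('X * q)`_j + (obeta mu k * (U k - t)) * q`_j.
  by rewrite q2E coefD coefZ !coefXM; case: j => [|j]/=; rewrite ?coefZ; ring.
have q0 j : (k < j)%N -> q`_j = 0 by move=> kj; rewrite nth_default ?(leq_trans sq).
have Xq0 j : (k.+1 < j)%N -> ('X * q)`_j = 0.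
  by case: j => // j; rewrite coefXM/= ltnS; exact: q0.
have sq1 : (size q1 <= k.+3)%N.
  apply/leq_sizeP => -[//|j] kj; rewrite q1c Xq0 ?q0; [ring|lia..].
have sq2 : (size q2 <= k.+2)%N.
  apply/leq_sizeP => j kj; rewrite q2c Xq0 ?q0; [ring|lia..].
have -> : forall x y z : R, - x - (y - x) - z = - (y + z) by move=> *; ring.
rewrite !(momfun_opoly Lpos)// !q1c !q2c (q0 k.+1) ?(q0 k.+2)// [('X * q)`_k.+1]coefXM/=.
rewrite (onormS Lpos) osubS -[k.+2%:R]natr1 /structU; ring.
Qed.

(** Second row of M, by the same two stages: top coefficients, then pairing with an arbitrary q of
    degree at most k. *)
Lemma structure_opoly k : ('X * 'X - 'X) * (P k)^`() =
  - (t%:P * 'X + (V k - t)%:P) * P k.+1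
  + (t%:P * 'X * 'X - (n k + t - g + b)%:P * 'X + (X k - g)%:P) * P k.
Proof.
set Rm := RHS; apply/eqP; rewrite -subr_eq0; apply/eqP.
set r := _ - _; have sr : (size r <= k.+1)%N.
  apply/leq_sizeP => -[//|j]; rewrite ltnS => kj.
  have -> : r = 'X * ('X * (P k)^`() + t *: P k.+1 - t *: ('X * P k)
      + (n k + t - g + b) *: P k)
     - 'X * (P k)^`() + (V k - t) *: P k.+1 - (X k - g) *: P k.
    by rewrite /r /Rm -!mul_polyC; ring.
  rewrite !(coefB, coefD, coefZ) coefXM/= !(coefB, coefD, coefZ) !coef_euler.
  rewrite [(P k)`_j.+1]nth_default ?size_opoly ?ltnS//.
  move: kj; rewrite leq_eqVlt => /orP[/eqP<-|].
    rewrite !opoly_sublead !opoly_lead coefX_opoly osubS /structV -!natr1; ring.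
  rewrite leq_eqVlt => /orP[/eqP<-|kj].
    rewrite opoly_lead [(P k.+1)`_k.+2]nth_default ?size_opoly//.
    by rewrite coefXM/= opoly_lead [(P k)`_k.+1]nth_default ?size_opoly//; ring.
  rewrite coefXM; case: j kj => // j kj /=.
  by rewrite !nth_default ?size_opoly//; [ring|lia..].
apply: (momfun_sq_eq0 Lpos); move: {-2}r sr => q sq.
(* The quadratic terms of the two factors of [P k] cancel. *)
pose q1 := (2 *: 'X - 1 - n k *: 'X + (X k)%:P) * q + ('X * 'X - 'X) * q^`().
pose q2 := (t%:P * 'X + (V k - t)%:P) * q.
have -> : r * q = ('X * 'X - 'X) * (P k)^`() * q
   - P k * (q1 - (('X * 'X - 'X) * q^`() + pearson_weight * q)) + P k.+1 * q2.
  by rewrite /r /Rm /q1 /q2 /pearson_weight -!mul_polyC; ring.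
rewrite momfunD !mulrBr !momfunB pearson_mul.
have -> : forall x y z : R, - x - (y - x) + z = z - y by move=> *; ring.
have q1E : q1 = 'X * ('X * q^`() + (2 - n k) *: q) - 'X * q^`() + (X k - 1) *: q.
  by rewrite /q1 -!mul_polyC; ring.
have q2E : q2 = 'X * (t *: q) + (V k - t) *: q.
  by rewrite /q2 -!mul_polyC; ring.
have q1c j : q1`_j = ('X * ('X * q^`() + (2 - n k) *: q))`_j - j%:R * q`_j
    + (X k - 1) * q`_j.
  by rewrite q1E !(coefB, coefD, coefZ) !coef_euler.
have q2c j : q2`_j.+1 = t * q`_j + (V k - t) * q`_j.+1.
  by rewrite q2E coefD coefZ !coefXM/= coefZ.
have q0 j : (k < j)%N -> q`_j = 0 by move=> kj; rewrite nth_default ?(leq_trans sq).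
have sq1 : (size q1 <= k.+2)%N.
  apply/leq_sizeP => -[//|j] kj.
  by rewrite q1c coefXM/= coefD coefZ coef_euler !q0; [ring|lia..].
have sq2 : (size q2 <= k.+3)%N.
  by apply/leq_sizeP => -[//|j] kj; rewrite q2c !q0; [ring|lia..].
rewrite !(momfun_opoly Lpos)// !q1c !q2c (q0 k.+1) ?(q0 k.+2)//.
have Xq1 c j : ('X * ('X * q^`() + c *: q))`_j = (j%:R - 1 + c) * ('X * q)`_j.
  rewrite !coefXM; case: j => [|j]/=; first by rewrite mulr0.
  by rewrite coefD coefZ coef_euler -natr1; ring.
rewrite !Xq1 [('X * q)`_k.+1]coefXM/= (onormS Lpos) /structX -!natr1; ring.
Qed.

(** The vector of values of P_(k+1) and P_k at c lies in the kernel of the matrix and is nonzero, as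
    there is no common root; hence the determinant vanishes. It is applied where y^2 - y
    vanishes. *)
Lemma quadric_at k (c m11 m12 m21 m22 : R) :
    m11 * (P k.+1).[c] + m12 * (P k).[c] = 0 ->
    m21 * (P k.+1).[c] + m22 * (P k).[c] = 0 ->
  m11 * m22 = m12 * m21.
Proof.
move: (@opoly_no_common_root _ mu Lpos k c); rewrite /root.
set p := _.[c]; set q := _.[c] => pq e1 e2; apply/eqP; rewrite -subr_eq0.
have dp : (m11 * m22 - m12 * m21) * p = 0.
  have -> : (m11 * m22 - m12 * m21) * p =
    m22 * (m11 * p + m12 * q) - m12 * (m21 * p + m22 * q) by ring.
  by rewrite e1 e2 !mulr0 subrr.
have dq : (m11 * m22 - m12 * m21) * q = 0.
  have -> : (m11 * m22 - m12 * m21) * q =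
    m11 * (m21 * p + m22 * q) - m21 * (m11 * p + m12 * q) by ring.
  by rewrite e1 e2 !mulr0 subrr.
apply/negPn/negP => d0; apply: pq.
  by move/eqP: dp; rewrite mulf_eq0 (negbTE d0).
by move/eqP: dq; rewrite mulf_eq0 (negbTE d0).
Qed.

Lemma quadric0 k :
  X k * (X k - g) = obeta mu k * (U k - t) * (V k - t).
Proof.
have e1 := congr1 (horner^~ 0) (structure_opolyS k).
have e2 := congr1 (horner^~ 0) (structure_opoly k).
have := @quadric_at k 0 (- X k) (obeta mu k * (U k - t)) (- (V k - t)) (X k - g).
move: e1 e2; rewrite !(hornerM, hornerD, hornerN, hornerX, hornerC) => e1 e2 h.
suff : - X k * (X k - g) = obeta mu k * (U k - t) * - (V k - t).
  by move=> /(congr1 -%R); rewrite mulNr mulrN !opprK.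
by apply: h; [apply: etrans (etrans (esym e1) _)|apply: etrans (etrans (esym e2) _)]; ring.
Qed.

Lemma quadric1 k :
  (X k - n k) * (X k - n k - b) = obeta mu k * U k * V k.
Proof.
have e1 := congr1 (horner^~ 1) (structure_opolyS k).
have e2 := congr1 (horner^~ 1) (structure_opoly k).
have := @quadric_at k 1 (n k - X k) (obeta mu k * U k) (- V k) (X k - n k - b).
move: e1 e2; rewrite !(hornerM, hornerD, hornerN, hornerX, hornerC) => e1 e2 h.
suff : (n k - X k) * (X k - n k - b) = obeta mu k * U k * - V k.
  by move=> /(congr1 -%R); rewrite -mulNr opprB mulrN opprK.
by apply: h; [apply: etrans (etrans (esym e1) _)|apply: etrans (etrans (esym e2) _)]; ring.
Qed.

(* [sigma], [s1], [s2] stand for t s_n - n (g - n) and its first two derivatives,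
   computed from s_n' = b_n and b_n' = b_n (a_(n-1) - a_n). *)
Lemma sigma_form k (N := n k) (a := g - 2 * N - b)
    (sigma := t * osub mu k.+1 - N * (N + a + b))
    (s1 := osub mu k.+1 + t * obeta mu k)
    (s2 := 2 * obeta mu k
       + t * (obeta mu k * (oalpha mu k - oalpha mu k.+1))) :
  (t * s2) ^+ 2 = (t * s1 - sigma + a * s1) ^+ 2
    - 4 * (t * s1 - sigma - N * (N + a + b)) * s1 * (s1 - b).
Proof.
have q0 := quadric0 k; have q1 := quadric1 k.
(* Since X = N + s1, both determinant conditions become relations in s1, and s2 only involves U -
   V. *)
have XE : X k = N + s1 by rewrite /structX /s1 /N; ring.
have s2E : s2 = - (obeta mu k * (U k - V k)).
  by rewrite /s2 /structU /structV; ring.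
have sE : sigma = t * s1 - t ^+ 2 * obeta mu k - N * (N + a + b).
  by rewrite /sigma /s1; ring.
move: q0 q1 sE; rewrite {}XE {}s2E {}/sigma -/N.
have -> : g = a + 2 * N + b by rewrite /a; ring.
clearbody a s1 N.
move: (obeta mu k) (U k) (V k) s1 a N => B u v s a' N' q0 q1 ->.
(* The difference of the two conditions is linear in U + V, while [q1] gives the product U V. Hence
   the square of U - V, that is of s2, follows from (U - V)^2 = (U + V)^2 - 4 U V. *)
have e : t * (B * (u + v)) = t ^+ 2 * B - (N' + s) * (N' + s - (a' + 2 * N' + b))
    + (N' + s - N') * (N' + s - N' - b).
  by rewrite q0 q1; ring.
have -> : (t * - (B * (u - v))) ^+ 2 = (t * (B * (u + v))) ^+ 2
    - 4 * t ^+ 2 * B * (B * u * v) by ring.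
by rewrite -q1 e; ring.
Qed.

End StructureRelations.

(** * The Hankel determinant as a product of norms *)

Section HankelDeterminant.
Context {R : realFieldType}.
Variable mu : nat -> R.
Local Notation L := (momfun mu).
Hypothesis Lpos : forall p : {poly R}, p != 0 -> 0 < L (p * p).

Lemma momfun_Xn_mul (p : {poly R}) i N : (size p <= N)%N ->
  L (p * 'X^i) = \sum_(l < N) p`_l * mu (i + l)%N.
Proof.
move=> sp; rewrite -[p in LHS]coefK poly_def mulr_suml linear_sum/=.
rewrite (big_ord_widen N (fun l => L (p`_l *: 'X^l * 'X^i)) sp) big_mkcond.
apply: eq_bigr => l _; case: ltnP => [_|sl].
  by rewrite -scalerAl momfunZ -exprD momfunXn addnC.
by rewrite nth_default ?mul0r.
Qed.

(** Let W hold the coefficients of P_j in column j; it is unit upper triangular. By orthogonality H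
    W is lower triangular, with the norms on its diagonal. *)
Lemma det_hankel k :
  \det (\matrix_(i < k, j < k) mu (i + j)%N) = \prod_(j < k) onorm mu j.
Proof.
set H := \matrix_(_, _) _.
pose W := \matrix_(i < k, j < k) (opoly mu j)`_i.
have detW : \det W = 1.
  rewrite -det_tr det_trig.
    by rewrite big1// => i _; rewrite !mxE opoly_lead.
  by apply/is_trig_mxP => i j ij; rewrite !mxE nth_default ?size_opoly.
have HW i j : (H *m W) i j = L (opoly mu j * 'X^i).
  rewrite (@momfun_Xn_mul _ _ k) ?size_opoly// mxE.
  by apply: eq_bigr => l _; rewrite !mxE mulrC.
rewrite -[LHS]mulr1 -{1}detW -det_mulmx det_trig.
    apply: eq_bigr => i _; rewrite HW (momfun_opoly Lpos) ?size_polyXn//.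
  by rewrite !coefXn eqxx gtn_eqF// mul0r subr0 mul1r.
by apply/is_trig_mxP => i j ij; rewrite HW (opoly_orth Lpos) ?size_polyXn.
Qed.

End HankelDeterminant.

(** * Derivatives of products, sums and polynomial-valued functions *)

Section DeriveLemmas.
Context {R : realType}.
Implicit Types (f g : R -> R) (t : R).

Lemma is_deriveMf f g t df dg : is_derive t 1 f df -> is_derive t 1 g dg ->
  is_derive t 1 (fun u => f u * g u) (df * g t + f t * dg).
Proof.
move=> hf hg; apply: (is_derive_eq (is_deriveM hf hg)).
by rewrite -[LHS]/(f t * dg + g t * df) addrC mulrC.
Qed.

Lemma is_deriveVf f t df : f t != 0 -> is_derive t 1 f df ->
  is_derive t 1 (fun u => (f u)^-1) (- df / f t ^+ 2).
Proof.
move=> f0 hf; apply: DeriveDef.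
  by apply: derivableV => //; exact: ex_derive.
have hf' : derivable f t 1 by exact: ex_derive.
rewrite deriveV//.
by rewrite derive_val -[LHS]/(- (f t) ^- 2 * df) !mulNr mulrC.
Qed.

Lemma is_derive_sumf n (f : 'I_n -> R -> R) t df :
  (forall i, is_derive t 1 (f i) (df i)) ->
  is_derive t 1 (fun u => \sum_(i < n) f i u) (\sum_(i < n) df i).
Proof.
move=> hf; have := @is_derive_sum _ _ _ _ _ t 1 _ hf.
by rewrite (_ : \sum_i f i = fun u => \sum_i f i u)//; apply/funext => u; rewrite fct_sumE.
Qed.

Lemma is_derive_prod_log n (f : nat -> R -> R) (a : nat -> R) t :
  (forall i, is_derive t 1 (f i) (a i * f i t)) ->
  is_derive t 1 (fun u => \prod_(i < n) f i u)
    ((\sum_(i < n) a i) * \prod_(i < n) f i t).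
Proof.
move=> hf; elim: n => [|n IH].
  rewrite !big_ord0 mul0r (_ : (fun _ => _) = cst 1); first exact: is_derive_cst.
  by apply/funext => u; rewrite big_ord0.
rewrite (_ : (fun _ => _) = fun u => (\prod_(i < n) f i u) * f n u); last first.
  by apply/funext => u; rewrite big_ord_recr.
apply: is_derive_eq (is_deriveMf IH (hf n)) _.
by rewrite !big_ord_recr/=; ring.
Qed.

(** Transfers derivatives along identities that are available only for positive parameters. *)
Lemma gt0_near_eq_is_derive f g t df : 0 < t ->
  (forall u, 0 < u -> f u = g u) -> is_derive t 1 f df -> is_derive t 1 g df.
Proof.
move=> t0 fg; apply: near_eq_is_derive; near=> u; apply: fg.
by near: u; exact: lt_nbhsr.
Unshelve. all: by end_near. Qed.

(** Differentiation is coefficientwise, so no topology on polynomials is involved. *)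
Definition is_pderive (p : R -> {poly R}) t (dp : {poly R}) :=
  forall i, is_derive t 1 (fun u => (p u)`_i) dp`_i.

Lemma is_pderiveM p q t dp dq : is_pderive p t dp -> is_pderive q t dq ->
  is_pderive (fun u => p u * q u) t (dp * q t + p t * dq).
Proof.
move=> hp hq i; rewrite (_ : (fun _ => _) =
    fun u => \sum_(j < i.+1) (p u)`_j * (q u)`_(i - j)); last first.
  by apply/funext => u; rewrite coefM.
rewrite coefD !coefM -big_split/=; apply: is_derive_sumf => j.
exact: is_deriveMf.
Qed.

Lemma is_pderive_cst (p : {poly R}) t : is_pderive (fun=> p) t 0.
Proof. by move=> i; rewrite coef0; exact: is_derive_cst. Qed.

Lemma is_pderive_size (p : R -> {poly R}) t dp N :
  is_pderive p t dp -> (forall u, (size (p u) <= N)%N) -> (size dp <= N)%N.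
Proof.
move=> hp sp; apply/leq_sizeP => j Nj.
have : is_derive t 1 (fun u => (p u)`_j) 0.
  rewrite (_ : (fun _ => _) = cst 0); first exact: is_derive_cst.
  by apply/funext => u; rewrite nth_default// (leq_trans (sp u)).
by case: (hp j) => _ <- [_ ->].
Qed.

End DeriveLemmas.

(** * Toda equations: dependence of the orthogonal polynomials on t *)

Section Toda.
Context {R : realType}.
Variable mu : R -> nat -> R.
Implicit Types (t : R) (k : nat).
Local Notation L t := (momfun (mu t)).
Hypothesis Lpos : forall t : R, 0 < t -> forall p : {poly R}, p != 0 ->
  0 < L t (p * p).
Hypothesis mu_derive : forall t : R, 0 < t -> forall i,
  is_derive t 1 (fun u => mu u i) (- mu t i.+1).

Local Notation P k := (fun u => opoly (mu u) k).

(** Product rule: the coefficients contribute L(dp), the moments - L(X p). The degree bound N is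
    uniform in u, so that the sum has fixed length. *)
Lemma is_derive_momfun (p : R -> {poly R}) t dp N : 0 < t ->
  (forall u, (size (p u) <= N)%N) -> is_pderive p t dp ->
  is_derive t 1 (fun u => L u (p u)) (L t dp - L t ('X * p t)).
Proof.
move=> t0 sp hp; rewrite (_ : (fun _ => _) =
    fun u => \sum_(j < N) (p u)`_j * mu u j); last first.
  by apply/funext => u; rewrite (momfunE _ (sp u)).
rewrite -momfun_shift (momfunE _ (sp t)) (momfunE _ (is_pderive_size hp sp)).
rewrite -sumrB; apply: is_derive_sumf => j.
apply: is_derive_eq (is_deriveMf (hp j) (mu_derive t0 j)) _.
by rewrite mulrN.
Qed.

Lemma is_derive_momfunM (p q : R -> {poly R}) t dp dq M N : 0 < t ->
  (forall u, (size (p u) <= M)%N) -> (forall u, (size (q u) <= N)%N) ->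
  is_pderive p t dp -> is_pderive q t dq ->
  is_derive t 1 (fun u => L u (p u * q u))
    (L t (dp * q t) + L t (p t * dq) - L t ('X * (p t * q t))).
Proof.
move=> t0 sp sq hp hq; rewrite -momfunD.
apply: (@is_derive_momfun _ _ _ (M + N)) => //; last exact: is_pderiveM.
move=> u; apply: (leq_trans (size_polyMleq _ _)).
by rewrite (leq_trans (leq_pred _))// leq_add.
Qed.

(** The leading coefficient is constantly 1, so the degree drops; the second claim is the derivative
    of L(P_k q) = 0 for fixed q. *)
Lemma is_pderive_orth k t dp : 0 < t -> is_pderive (P k) t dp ->
  [/\ (size dp <= k)%N &
   forall q : {poly R}, (size q <= k)%N ->
     L t (dp * q) = L t ('X * (opoly (mu t) k * q))].
Proof.
move=> t0 hp; split.
  have sdp : (size dp <= k.+1)%N.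
    by apply: (is_pderive_size hp) => u; rewrite size_opoly.
  apply/leq_sizeP => j; rewrite leq_eqVlt => /orP[/eqP<-|kj]; last first.
    by rewrite nth_default// (leq_trans sdp).
  have : is_derive t 1 (fun u => (opoly (mu u) k)`_k) 0.
    rewrite (_ : (fun _ => _) = cst 1); first exact: is_derive_cst.
    by apply/funext => u; rewrite opoly_lead.
  by case: (hp k) => _ <- [_ ->].
move=> q sq.
have h1 : is_derive t 1 (fun u => L u (opoly (mu u) k * q)) 0.
  apply: (@gt0_near_eq_is_derive _ (cst 0)) => //.
  by move=> u u0; rewrite (opoly_orth (Lpos u0)).
have := is_derive_momfunM t0 _ _ hp (is_pderive_cst q t).
move=> /(_ k.+1 (size q)) -[||_].
- by move=> u; rewrite size_opoly.
- by [].
case: h1 => _ -> /esym/eqP; rewrite mulr0 momfun0 addr0 subr_eq0.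
by move/eqP.
Qed.

(** The terms with the derivative of P_k vanish by orthogonality, leaving - L(X P_k^2). The
    derivative of P_k is assumed here because its existence is only obtained in [opoly_pderivable],
    by an induction that uses this lemma. *)
Lemma is_derive_onorm_of k t dp : 0 < t -> is_pderive (P k) t dp ->
  is_derive t 1 (fun u => onorm (mu u) k)
    (- oalpha (mu t) k * onorm (mu t) k).
Proof.
move=> t0 hp; have [sdp _] := is_pderive_orth t0 hp.
have sP u : (size (opoly (mu u) k) <= k.+1)%N by rewrite size_opoly.
apply: is_derive_eq (is_derive_momfunM t0 sP sP hp hp) _.
rewrite [dp * _]mulrC (opoly_orth (Lpos t0)) ?leqW// addr0 add0r.
by rewrite (oalphaM (Lpos t0)) mulNr.
Qed.

Lemma is_derive_oalpha_of k t dp : 0 < t -> is_pderive (P k) t dp ->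
  exists da, is_derive t 1 (fun u => oalpha (mu u) k) da.
Proof.
move=> t0 hp; have h0 := onorm_neq0 (Lpos t0) k.
have sP u : (size (opoly (mu u) k) <= k.+1)%N by rewrite size_opoly.
have sXP u : (size ('X * opoly (mu u) k)%R <= k.+2)%N.
  by rewrite mulrC size_mulX ?opoly_neq0// size_opoly.
have hXP := is_pderiveM (is_pderive_cst 'X t) hp.
have h1 := is_derive_momfunM t0 sXP sP hXP hp.
have h2 := is_deriveVf h0 (is_derive_onorm_of t0 hp).
have := is_deriveMf h1 h2; set da := (X in is_derive _ _ _ X).
rewrite (_ : (fun _ => _) = fun u => oalpha (mu u) k); first by exists da.
by apply/funext => u; rewrite /oalpha mulrA.
Qed.

Lemma is_derive_obeta_of k t dp dq : 0 < t ->
  is_pderive (P k) t dp -> is_pderive (P k.+1) t dq ->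
  is_derive t 1 (fun u => obeta (mu u) k)
    (obeta (mu t) k * (oalpha (mu t) k - oalpha (mu t) k.+1)).
Proof.
move=> t0 hp hq; have h0 := onorm_neq0 (Lpos t0) k.
apply: is_derive_eq (is_deriveMf (is_derive_onorm_of t0 hq)
  (is_deriveVf h0 (is_derive_onorm_of t0 hp))) _.
by rewrite /obeta; field.
Qed.

Lemma is_pderiveZ (f : R -> R) (p : R -> {poly R}) t df dp :
  is_derive t 1 f df -> is_pderive p t dp ->
  is_pderive (fun u => f u *: p u) t (df *: p t + f t *: dp).
Proof.
move=> hf hp i; rewrite (_ : (fun _ => _) = fun u => f u * (p u)`_i).
  by rewrite coefD !coefZ; exact: is_deriveMf.
by apply/funext => u; rewrite coefZ.
Qed.

Lemma is_pderiveB (p q : R -> {poly R}) t dp dq :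
  is_pderive p t dp -> is_pderive q t dq ->
  is_pderive (fun u => p u - q u) t (dp - dq).
Proof.
move=> hp hq i; rewrite (_ : (fun _ => _) = fun u => (p u)`_i - (q u)`_i).
  by rewrite coefB; exact: is_deriveB.
by apply/funext => u; rewrite coefB.
Qed.

Lemma is_pderiveC (f : R -> R) t df :
  is_derive t 1 f df -> is_pderive (fun u => (f u)%:P) t df%:P.
Proof.
move=> hf [|i]; rewrite coefC/=.
  by rewrite (_ : (fun _ => _) = f)//; apply/funext => u; rewrite coefC.
rewrite (_ : (fun _ => _) = cst 0); first exact: is_derive_cst.
by apply/funext => u; rewrite coefC.
Qed.

(** Induction on two consecutive polynomials: their derivatives yield those of the recurrence
    coefficients, and the recurrence then yields that of the next polynomial. *)
Lemma opoly_pderivable k t : 0 < t ->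
  (exists dp, is_pderive (P k) t dp) /\ (exists dp, is_pderive (P k.+1) t dp).
Proof.
move=> t0; elim: k => [|k [[dp hp] [dq hq]]]; split.
- by exists 0; exact: is_pderive_cst.
- have [da ha] := is_derive_oalpha_of t0 (is_pderive_cst 1 t : is_pderive (P 0) t 0).
  exists (0 - da%:P) => i.
  rewrite (_ : (fun _ => _) = fun u => ('X - (oalpha (mu u) 0)%:P)`_i).
    exact: (is_pderiveB (is_pderive_cst 'X t) (is_pderiveC ha)).
  by apply/funext => u; rewrite opoly1.
- by exists dq.
have [da ha] := is_derive_oalpha_of t0 hq.
have hb := is_derive_obeta_of t0 hp hq.
have := is_pderiveB (is_pderiveM
  (is_pderiveB (is_pderive_cst 'X t) (is_pderiveC ha)) hq) (is_pderiveZ hb hp).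
set dr := (X in is_pderive _ _ X) => hr; exists dr => i; have := hr i.
rewrite (_ : (fun _ => _) = fun u => (opoly (mu u) k.+2)`_i)//.
by apply/funext => u; rewrite opolySS.
Qed.

Lemma is_derive_onorm k t : 0 < t -> is_derive t 1 (fun u => onorm (mu u) k)
  (- oalpha (mu t) k * onorm (mu t) k).
Proof.
by move=> t0; have [[dp hp] _] := opoly_pderivable k t0; exact: is_derive_onorm_of hp.
Qed.

Lemma is_derive_obeta k t : 0 < t -> is_derive t 1 (fun u => obeta (mu u) k)
  (obeta (mu t) k * (oalpha (mu t) k - oalpha (mu t) k.+1)).
Proof.
move=> t0; have [[dp hp] [dq hq]] := opoly_pderivable k t0.
exact: is_derive_obeta_of hp hq.
Qed.

(** The difference of dP_(k+1)/dt and b_(k+1) P_k has degree at most k. It is orthogonal to each q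
    of that degree, as both pairings equal the coefficient of X^k in q times [onorm] of index
    k+1. *)
Lemma is_pderive_opoly k t : 0 < t ->
  is_pderive (P k.+1) t (obeta (mu t) k *: opoly (mu t) k).
Proof.
move=> t0; have [_ [dp hp]] := opoly_pderivable k t0.
have [sdp orth] := is_pderive_orth t0 hp.
suff <- : dp = obeta (mu t) k *: opoly (mu t) k by [].
apply/eqP; rewrite -subr_eq0; apply/eqP; apply: (momfun_sq_eq0 (Lpos t0)).
set r := dp - _; have : (size r <= k.+1)%N.
  rewrite (leq_trans (size_polyD _ _))// geq_max sdp size_polyN.
  by rewrite (leq_trans (size_scale_leq _ _))// size_opoly.
move: {1 3}r => q sq.
rewrite /r mulrBl momfunB orth// -scalerAl momfunZ.
rewrite mulrCA !(momfun_opoly (Lpos t0)) ?(leqW sq)//; last first.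
  have [->|q0] := eqVneq q 0; first by rewrite mulr0 size_poly0.
  by rewrite mulrC size_mulX// leqW.
rewrite coefXM/= (onormS (Lpos t0)) coefXM/=.
rewrite ![q`_k.+1]nth_default//; ring.
Qed.

Lemma is_derive_osubS k t : 0 < t ->
  is_derive t 1 (fun u => osub (mu u) k.+1) (obeta (mu t) k).
Proof.
move=> t0; have := is_pderive_opoly k t0 k.
rewrite coefZ opoly_lead mulr1; under eq_fun do rewrite opoly_sublead.
by [].
Qed.

(** Each norm has logarithmic derivative - a_j, and these sum to s_k. *)
Lemma is_derive_ln_hankel k t : 0 < t ->
  is_derive t 1 (fun u => ln (\det (\matrix_(i < k, j < k) mu u (i + j)%N)))
    (osub (mu t) k).
Proof.
move=> t0; apply: (@gt0_near_eq_is_derive _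
  (fun u => ln (\prod_(j < k) onorm (mu u) j))) => //.
  by move=> u u0; rewrite (det_hankel (Lpos u0)).
have pr0 : 0 < \prod_(j < k) onorm (mu t) j.
  by apply: prodr_gt0 => j _; exact: onorm_gt0 (Lpos t0) j.
have h := @is_derive_prod_log _ k (fun j u => onorm (mu u) j)
  (fun j => - oalpha (mu t) j) t (fun j => is_derive_onorm j t0).
have h1 := is_derive1_ln pr0.
apply: is_derive_eq (is_derive1_comp h1 h) _.
rewrite sumrN -/(osub _ _) -[LHS]/(_ * _).
by field; rewrite gt_eqF.
Qed.

End Toda.

(** * The concrete weight: bounds, derivatives, limits at the endpoints and moments *)

Section Weight.
Context {R : realType}.
Variables (a : R) (c : nat).
Hypothesis a0 : 0 < a.
Implicit Types (b t x y : R) (j : nat).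

(** Up to the Jacobian this is y^j against the weight in y = 1/x. The power c is later 2(n - 1), and
    j may exceed it, hence the separate factor x^(-j). *)
Definition inv_integrand b t j x : R := (x^-1) ^+ j * moment_integrand a b t c x.
Local Notation G := inv_integrand.

Lemma inv_integrand0 b t j : G b t j 0 = 0.
Proof. by rewrite /inv_integrand /moment_integrand powR0 ?gt_eqF// mulr0 mul0r mulr0. Qed.

Lemma inv_integrand1 b t j : b != 0 -> G b t j 1 = 0.
Proof. by move=> b0; rewrite /inv_integrand /moment_integrand subrr powR0// !mulr0. Qed.

Lemma inv_integrandS b t j x : G b t j.+1 x = x^-1 * G b t j x.
Proof. by rewrite /inv_integrand exprS mulrA. Qed.

Lemma inv_integrand_gt0 b t j x : 0 < x < 1 -> 0 < G b t j x.
Proof.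
move=> /andP[x0 x1]; rewrite /inv_integrand /moment_integrand.
by rewrite !mulr_gt0 ?exprn_gt0 ?invr_gt0 ?expR_gt0 ?powR_gt0 ?subr_gt0.
Qed.

Lemma inv_integrand_ge0 b t j x : 0 <= x -> 0 <= G b t j x.
Proof.
move=> x0; rewrite /inv_integrand /moment_integrand.
by rewrite !mulr_ge0 ?exprn_ge0 ?invr_ge0 ?expR_ge0 ?powR_ge0.
Qed.

Lemma expRN_le j y : 0 < y -> y ^+ j * expR (- y) <= j`!%:R.
Proof.
move=> y0; rewrite expRN ler_pdivrMr ?expR_gt0//.
case: j => [|j].
  by rewrite expr0 fact0 mul1r (le_trans _ (expR_ge1Dx _))// lerDl ltW.
have := expR_ge1Dxn j (ltW y0).
have f0 : 0 < (j.+1)`!%:R :> R by rewrite ltr0n fact_gt0.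
move=> h; have : y ^+ j.+1 / (j.+1)`!%:R <= expR y by apply: le_trans h; rewrite lerDr.
by rewrite ler_pdivrMr// mulrC.
Qed.

(** The negative powers of x are absorbed by the exponential, through [expRN_le] at y = t/x. The
    factors x^a and (1 - x)^b are kept since they force the limits 0 at the endpoints. *)
Lemma inv_integrand_le b t j x : 0 <= b -> 0 < t -> 0 <= x <= 1 ->
  G b t j x <= j`!%:R / t ^+ j * (x `^ a * (1 - x) `^ b).
Proof.
move=> b0' t0 /andP[]; rewrite le_eqVlt => /orP[/eqP<- _|x0 x1].
  by rewrite inv_integrand0 powR0 ?gt_eqF// mul0r mulr0.
rewrite /inv_integrand /moment_integrand.
have -> : x^-1 ^+ j * (x ^+ c * expR (- (t / x)) * x `^ a * (1 - x) `^ b) =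
  ((t / x) ^+ j * expR (- (t / x))) / t ^+ j * (x `^ a * (1 - x) `^ b) * x ^+ c.
  by rewrite exprMn; field; rewrite expf_neq0// gt_eqF.
have h0 : 0 <= x `^ a * (1 - x) `^ b by rewrite mulr_ge0 ?powR_ge0.
have t0' : 0 <= (t ^+ j)^-1 by rewrite invr_ge0 exprn_ge0 ?ltW.
rewrite (@le_trans _ _ ((t / x) ^+ j * expR (- (t / x)) / t ^+ j * (x `^ a * (1 - x) `^ b)))//.
  rewrite ler_piMr ?exprn_ile1 ?(ltW x0)//.
  do 3 (apply: mulr_ge0; rewrite ?expR_ge0//).
  by rewrite exprn_ge0// divr_ge0// ltW.
by rewrite ler_wpM2r// ler_wpM2r// expRN_le// divr_gt0.
Qed.

Lemma powR_unit_le1 (r x : R) : 0 <= r -> 0 <= x <= 1 -> x `^ r <= 1.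
Proof.
move=> r0 /andP[x0 x1].
by rewrite (le_trans (ge0_ler_powR r0 _ _ x1)) ?powR1 ?nnegrE.
Qed.

Lemma inv_integrand_le_cst b t j x : 0 <= b -> 0 < t -> 0 <= x <= 1 ->
  G b t j x <= j`!%:R / t ^+ j.
Proof.
move=> b0' t0 x01; apply: (le_trans (inv_integrand_le _ _ _ _)) => //.
rewrite ler_piMr ?divr_ge0 ?exprn_ge0 ?ler0n// ?(ltW t0)//.
rewrite mulr_ile1 ?powR_ge0 ?powR_unit_le1//; first exact: ltW.
by move: x01 => /andP[? ?]; rewrite subr_ge0 lerBlDr lerDl; apply/andP.
Qed.

Lemma inv_integrandE b t j x : 0 < x ->
  G b t j x = expR (- (t / x)) * x `^ (a + c%:R - j%:R) * (1 - x) `^ b.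
Proof.
move=> x0; rewrite /inv_integrand /moment_integrand.
have xn0 : x != 0 by rewrite gt_eqF.
rewrite powRB ?xn0 ?implybT// powRD ?xn0 ?implybT// !powR_mulrn ?ltW//.
by rewrite exprVn; field; rewrite expf_neq0.
Qed.

(** With exponent b + 1 the derivative is a combination of integrands of exponent b, because (1 -
    x)^(b+1) = (1 - x) (1 - x)^b. Integrated over [0, 1] it becomes the moment recurrence. *)
Lemma is_derive_inv_integrand b t j x : 0 < x < 1 ->
  is_derive x 1 (G (b + 1) t j)
   (t * G b t j.+2 x + (a + c%:R - j%:R - t) * G b t j.+1 x
     - (a + c%:R - j%:R + b + 1) * G b t j x).
Proof.
move=> /andP[x0 x1]; have xn0 : x != 0 by rewrite gt_eqF.
have y0 : 0 < 1 - x by rewrite subr_gt0.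
pose e := a + c%:R - j%:R.
apply: (@gt0_near_eq_is_derive _
  (fun u => expR (- (t * u^-1)) * u `^ e * (1 - u) `^ (b + 1))) => //.
  by move=> u u0; rewrite inv_integrandE.
have h1 : is_derive x 1 (fun u => - (t * u^-1)) (t / x ^+ 2).
  have := is_deriveN (is_deriveMf (is_derive_cst t x 1) (is_deriveVf xn0 (is_derive_id x 1))).
  by move=> h; apply: is_derive_eq h _; rewrite /cst; field.
have h2 := is_derive1_comp (is_derive_expR _) h1.
have h3 := is_derive1_powR e x0.
pose g (u : R) := 1 - u.
have h4 : is_derive x 1 g (-1).
  have h := is_deriveB (is_derive_cst (1 : R) x 1) (is_derive_id x 1).
  by apply: is_derive_eq h _; rewrite sub0r.
have h5 := is_derive1_comp (is_derive1_powR (b + 1) (y0 : 0 < g x)) h4.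
apply: is_derive_eq (is_deriveMf (is_deriveMf h2 h3) h5) _.
rewrite /comp /g addrK !inv_integrandS inv_integrandE// -/e.
have -> : x `^ (e - 1) = x `^ e / x.
  by rewrite powRB ?xn0 ?implybT// powRr1// ltW.
have -> : (1 - x) `^ (b + 1) = (1 - x) `^ b * (1 - x).
  by rewrite powRD ?(gt_eqF y0) ?implybT// powRr1// ltW.
by field.
Qed.

Lemma inv_integrand_cvg0 b t j : 0 <= b -> 0 < t ->
  G b t j x @[x --> 0^'+] --> (0 : R).
Proof.
move=> b0 t0; apply: (@squeeze_cvgr _ _ _ _ (cst 0)
  (fun x => j`!%:R / t ^+ j * x `^ a)); last 2 first.
- exact: cvg_cst.
- rewrite -[X in _ --> X](mulr0 (j`!%:R / t ^+ j)).
  by apply: cvgM; [exact: cvg_cst|exact: powR_cvg0].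
near=> x.
have x0 : 0 < x by near: x; exact: nbhs_right_gt.
have x1 : x <= 1 by near: x; exact: nbhs_right_le.
have x01 : 0 <= x <= 1 by rewrite (ltW x0).
rewrite inv_integrand_ge0 ?(ltW x0)//= (le_trans (inv_integrand_le j b0 t0 x01))//.
rewrite ler_wpM2l ?divr_ge0 ?exprn_ge0 ?ler0n ?(ltW t0)//.
rewrite ler_piMr ?powR_ge0// powR_unit_le1//.
by rewrite subr_ge0 x1 lerBlDr lerDl (ltW x0).
Unshelve. all: by end_near. Qed.

Lemma inv_integrand_cvg1 b t j : 0 < b -> 0 < t ->
  G b t j x @[x --> 1^'-] --> (0 : R).
Proof.
move=> b0 t0; apply: (@squeeze_cvgr _ _ _ _ (cst 0)
  (fun x => j`!%:R / t ^+ j * (1 - x) `^ b)); last 2 first.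
- exact: cvg_cst.
- rewrite -[X in _ --> X](mulr0 (j`!%:R / t ^+ j)).
  apply: cvgM; first exact: cvg_cst.
  apply/cvgrPdist_lt => e e0.
  have /cvgrPdist_lt/(_ _ e0)[d /= d0 hd] := powR_cvg0 b0.
  near=> x; apply: (hd (1 - x)) => /=.
    rewrite sub0r normrN gtr0_norm ?subr_gt0; last by near: x; exact: nbhs_left_lt.
    rewrite ltrBlDl -ltrBlDr; near: x; apply: nbhs_left_gt.
    by rewrite ltrBlDr ltrDl.
  by rewrite subr_gt0; near: x; exact: nbhs_left_lt.
near=> x.
have x0 : 0 < x by near: x; exact: nbhs_left_gt.
have x1 : x <= 1 by near: x; exact: nbhs_left_le.
have x01 : 0 <= x <= 1 by rewrite (ltW x0).
rewrite inv_integrand_ge0 ?(ltW x0)//= (le_trans (inv_integrand_le j (ltW b0) t0 x01))//.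
rewrite ler_wpM2l ?divr_ge0 ?exprn_ge0 ?ler0n ?(ltW t0)//.
by rewrite ler_piMl ?powR_ge0// powR_unit_le1// ltW.
Unshelve. all: by end_near. Qed.

Lemma inv_integrand_derivable b t j x : 0 < x < 1 -> derivable (G b t j) x 1.
Proof.
move=> x01; have := is_derive_inv_integrand (b - 1) t j x01.
by rewrite subrK => h; exact: ex_derive.
Qed.

Lemma inv_integrand_continuous b t j : 0 < b -> 0 < t ->
  {within `[0, 1], continuous (G b t j)}.
Proof.
move=> b0 t0; apply/continuous_within_itvP; first exact: ltr01.
split.
- move=> x; rewrite in_itv/= => x01.
  apply: differentiable_continuous; apply/derivable1_diffP.
  exact: inv_integrand_derivable.
- by rewrite inv_integrand0; apply: inv_integrand_cvg0 => //; exact: ltW.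
- by rewrite inv_integrand1 ?gt_eqF//; exact: inv_integrand_cvg1.
Qed.

Local Notation lebesgue := (@lebesgue_measure R).

Lemma inv_integrand_integrable b t j : 0 < b -> 0 < t ->
  lebesgue.-integrable `[0, 1] (EFin \o G b t j).
Proof.
move=> b0 t0; apply: continuous_compact_integrable.
  exact: segment_compact.
exact: inv_integrand_continuous.
Qed.

Definition inv_moment b t j : R := \int[lebesgue]_(x in `[0, 1]) G b t j x.

Lemma integrable_cst_unit (k : R) :
  lebesgue.-integrable `[0, 1] (EFin \o cst k).
Proof.
apply: continuous_compact_integrable; first exact: segment_compact.
by apply: continuous_subspaceT => x; exact: cvg_cst.
Qed.

Lemma inv_moment_sum b t N (f : nat -> R) : 0 < b -> 0 < t ->
  lebesgue.-integrable `[0, 1] (EFin \o (fun x => \sum_(j < N) f j * G b t j x)) /\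
  \int[lebesgue]_(x in `[0, 1]) (\sum_(j < N) f j * G b t j x) =
    \sum_(j < N) f j * inv_moment b t j.
Proof.
move=> b0 t0; elim: N => [|N [IH1 IH2]].
  rewrite big_ord0.
  have -> : (fun x => \sum_(j < 0) f j * G b t j x) = cst 0.
    by apply/funext => x; rewrite big_ord0.
  split; first exact: integrable_cst_unit.
  by rewrite Rintegral_cst// mul0r.
have hN : lebesgue.-integrable `[0, 1] (EFin \o (fun x => f N * G b t N x)).
  rewrite (_ : _ \o _ = fun x => ((f N)%:E * (G b t N x)%:E)%E).
    by apply: integrableZl => //; exact: inv_integrand_integrable.
  by apply/funext => x; rewrite /= EFinM.
have -> : (fun x => \sum_(j < N.+1) f j * G b t j x) =
    (fun x => \sum_(j < N) f j * G b t j x + f N * G b t N x).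
  by apply/funext => x; rewrite big_ord_recr.
split.
  rewrite (_ : _ \o _ = fun x => ((\sum_(j < N) f j * G b t j x)%:E
      + (f N * G b t N x)%:E)%E).
    exact: integrableD.
  by apply/funext => x; rewrite /= EFinD.
rewrite RintegralD// IH2 big_ord_recr/=; congr (_ + _).
by rewrite RintegralZl//; exact: inv_integrand_integrable.
Qed.

Lemma inv_moment_derive b t j : 0 < b -> 0 < t ->
  is_derive t 1 (fun u => inv_moment b u j) (- inv_moment b t j.+1).
Proof.
move=> b0 t0.
have dG (u x : R) : is_derive u 1 (fun v => G b v j x) (- G b u j.+1 x).
  have h1 : is_derive u 1 (fun v => - (v * x^-1)) (- x^-1).
    have h := is_deriveN (is_deriveMf (is_derive_id u 1) (is_derive_cst (x^-1 : R) u 1)).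
    by apply: is_derive_eq h _; rewrite mul1r mulr0 addr0.
  have h2 := is_derive1_comp (is_derive_expR _) h1.
  have h := is_deriveMf (is_deriveMf (is_derive_cst (x^-1 ^+ j * x ^+ c) u 1) h2)
     (is_derive_cst (x `^ a * (1 - x) `^ b) u 1).
  rewrite (_ : (fun _ => _) = (fun v => x^-1 ^+ j * x ^+ c * expR (- (v * x^-1))
     * (x `^ a * (1 - x) `^ b))); last first.
    by apply/funext => v; rewrite /inv_integrand /moment_integrand; ring.
  apply: is_derive_eq h _.
  by rewrite inv_integrandS /inv_integrand /moment_integrand /cst/=; ring.
have d1E (u x : R) : partial1of2 (fun v y => G b v j y) u x = - G b u j.+1 x.
  by rewrite /partial1of2 derive1E; case: (dG u x).
have I : (`]t / 2, t + 1[%classic : set R) t.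
  by rewrite /= in_itv/=; apply/andP; split; lra.
have intf u : (`]t / 2, t + 1[%classic : set R) u ->
    lebesgue.-integrable `[0, 1] (EFin \o G b u j).
  rewrite /= in_itv/= => /andP[tu _]; apply: inv_integrand_integrable => //; lra.
(* The dominating constant: the uniform bound on the integrand of index j+1, taken at the left end
   t/2 of the parameter interval. *)
pose C := (j.+1)`!%:R / (t / 2) ^+ j.+1.
have t20 : 0 < t / 2 by lra.
have C0 : 0 <= C by rewrite divr_ge0 ?exprn_ge0 ?ler0n// ltW.
have intC : lebesgue.-integrable `[0, 1] (EFin \o (fun=> C)).
  exact: integrable_cst_unit.
have ub u x : (`]t / 2, t + 1[%classic : set R) u -> (`[0, 1]%classic : set R) x ->
    `|partial1of2 (fun v y => G b v j y) u x| <= C.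
  rewrite /= !in_itv/= => /andP[tu _] x01; rewrite d1E normrN ger0_norm.
    have u0 : 0 < u by lra.
    rewrite (le_trans (inv_integrand_le_cst _ (ltW b0) u0 x01))//.
    rewrite ler_wpM2l ?ler0n// lef_pV2 ?posrE ?exprn_gt0//.
    by rewrite lerXn2r ?nnegrE// ltW.
  by apply: inv_integrand_ge0; case/andP: x01.
have der u x : (`]t / 2, t + 1[%classic : set R) u -> (`[0, 1]%classic : set R) x ->
    derivable (fun v => G b v j x) u 1.
  by move=> _ _; have h := dG u x; exact: ex_derive.
apply: DeriveDef.
  exact: (@derivable_under_integral _ _ _ lebesgue (fun v y => G b v j y) _
    (measurable_itv _) _ _ _ I intf der (fun=> C) (fun=> C0) intC ub).
rewrite -derive1E.
rewrite (@differentiation_under_integral _ _ _ lebesgue (fun v y => G b v j y) _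
    (measurable_itv _) _ _ _ I intf der (fun=> C) (fun=> C0) intC ub).
rewrite -mulN1r -RintegralZl//; last exact: inv_integrand_integrable.
by apply: eq_Rintegral => x _; rewrite d1E mulN1r.
Qed.

End Weight.

(** * Pearson identity and positivity for the moments in 1/x *)

Section MomentProperties.
Context {R : realType}.
Variables (a b t : R) (c : nat).
Hypotheses (a0 : 0 < a) (b0 : 0 < b) (t0 : 0 < t).

Local Notation G := (inv_integrand a c b t).
Local Notation mu := (inv_moment a c b t).
Local Notation lebesgue := (@lebesgue_measure R).

Lemma momfun_inv_integrand (p : {poly R}) x :
  momfun (fun j => G j x) p = p.[x^-1] * moment_integrand a b t c x.
Proof.
rewrite horner_coef mulr_suml; apply: eq_bigr => i _.
by rewrite /inv_integrand mulrA.
Qed.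

Lemma integrable_momfun (p : {poly R}) :
  lebesgue.-integrable `[0, 1] (EFin \o (fun x => momfun (fun j => G j x) p)).
Proof. by have [] := inv_moment_sum c a0 (size p) (fun i => p`_i) b0 t0. Qed.

Lemma momfun_inv_moment (p : {poly R}) :
  momfun mu p = \int[lebesgue]_(x in `[0, 1]) momfun (fun j => G j x) p.
Proof. by have [_ ->] := inv_moment_sum c a0 (size p) (fun i => p`_i) b0 t0. Qed.

(** Integrate the derivative of the integrand of exponent b + 1 over [0, 1]; both boundary values
    are 0. *)
Lemma inv_moment_recurrence j :
  t * mu j.+2 + (a + c%:R - j%:R - t) * mu j.+1
    - (a + c%:R - j%:R + b + 1) * mu j = 0.
Proof.
pose q := t *: 'X^(j.+2) + (a + c%:R - j%:R - t) *: 'X^(j.+1)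
  - (a + c%:R - j%:R + b + 1) *: 'X^j.
have qE (nu : nat -> R) : momfun nu q = t * nu j.+2
    + (a + c%:R - j%:R - t) * nu j.+1 - (a + c%:R - j%:R + b + 1) * nu j.
  by rewrite momfunB momfunD !momfunZ !momfunXn.
rewrite -(qE mu) momfun_inv_moment.
have cG i : {within `[0, 1], continuous (G i)}.
  exact: inv_integrand_continuous.
have b1 : 0 < b + 1 by rewrite addr_gt0.
have := @continuous_FTC2 _ (fun x => momfun (fun j => G j x) q)
  (inv_integrand a c (b + 1) t j) 0 1 ltr01.
rewrite /Rintegral => ->.
- by rewrite inv_integrand0// inv_integrand1 ?gt_eqF// subee.
- rewrite (_ : (fun x => _) = fun x => t * G j.+2 x + (a + c%:R - j%:R - t) * G j.+1 x
    - (a + c%:R - j%:R + b + 1) * G j x); last first.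
    by apply/funext => x; rewrite qE.
  move=> x; apply: cvgB; last by apply: cvgM; [exact: cvg_cst|exact: cG].
  by apply: cvgD; (apply: cvgM; [exact: cvg_cst|exact: cG]).
- split.
  + by move=> x; rewrite in_itv/=; exact: inv_integrand_derivable.
  + by rewrite inv_integrand0//; apply: inv_integrand_cvg0 => //; exact: ltW.
  + by rewrite inv_integrand1 ?gt_eqF//; exact: inv_integrand_cvg1.
- move=> x; rewrite in_itv/= => x01; rewrite qE derive1E.
  by case: (@is_derive_inv_integrand _ a c b t j x x01).
Qed.

(** On X^j this is the negative of the moment recurrence. In g = a + c + b + 2 the summand 2 comes
    from dx = - dy/y^2. *)
Lemma inv_moment_pearson (p : {poly R}) :
  momfun mu (('X * 'X - 'X) * p^`()
    + pearson_weight t (a + c%:R + b + 2) b * p) = 0.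
Proof.
rewrite -[p]coefK poly_def.
elim/big_ind: _ => [|q r hq hr|j _]; first by rewrite deriv0 !mulr0 addr0 momfun0.
  rewrite derivD -[RHS](addr0 0) -{1}hq -hr -momfunD; congr momfun; ring.
rewrite derivZ -!scalerAr -scalerDr momfunZ; move: (p`_j) (nat_of_ord j) => u {}j.
have -> : ('X * 'X - 'X) * ('X^j)^`() =
    j%:R *: 'X^(j.+1) - j%:R *: 'X^j :> {poly R}.
  case: j => [|i]; first by rewrite expr0 derivC mulr0 !scale0r subrr.
  by rewrite derivXn -scaler_nat -!mul_polyC !exprS/=; ring.
have -> : j%:R *: 'X^(j.+1) - j%:R *: 'X^j
    + pearson_weight t (a + c%:R + b + 2) b * 'X^j =
  - (t *: 'X^(j.+2) + (a + c%:R - j%:R - t) *: 'X^(j.+1)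
  - (a + c%:R - j%:R + b + 1) *: 'X^j).
  by rewrite /pearson_weight -!mul_polyC !exprS; ring.
rewrite momfunN momfunB momfunD !momfunZ !momfunXn.
by rewrite inv_moment_recurrence oppr0 mulr0.
Qed.

Lemma finite_roots (p : {poly R}) : p != 0 -> finite_set [set x | root p x].
Proof.
move=> p0; apply: contrapT => /(infinite_set_fset (size p))[B Bp sB].
have rB : all (root p) (finmap.enum_fset B).
  by apply/allP => x xB; exact: Bp.
by have := max_poly_roots p0 rB (finmap.fset_uniq B); rewrite ltnNge sB.
Qed.

(** The integrand p(1/x)^2 G_0(x) is nonnegative. Were its integral 0, it would vanish almost
    everywhere, but its zeros in [0, 1] lie in the finite set Z of 0, 1 and the inverses of the
    roots of p; so [0, 1] would be a null set. *)
Lemma inv_moment_pos (p : {poly R}) : p != 0 -> 0 < momfun mu (p * p).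
Proof.
move=> p0; rewrite momfun_inv_moment.
set f := fun x => momfun (fun j => G j x) (p * p).
have fE x : f x = p.[x^-1] ^+ 2 * G 0 x.
  by rewrite /f momfun_inv_integrand hornerM /inv_integrand expr0 mul1r expr2.
have f0 x : (`[0, 1]%classic : set R) x -> 0 <= f x.
  rewrite /= in_itv/= => /andP[x0 _].
  by rewrite fE mulr_ge0 ?sqr_ge0// inv_integrand_ge0.
have intf : lebesgue.-integrable `[0, 1] (EFin \o f) by exact: integrable_momfun.
rewrite lt_neqAle Rintegral_ge0// andbT eq_sym; apply/eqP => Rif0.
have if0 : (\int[lebesgue]_(x in `[0%R, 1%R]) (f x)%:E = 0)%E.
  rewrite -[LHS]fineK; last exact: integrable_fin_num.
  by rewrite -[fine _]/(\int[lebesgue]_(x in `[0, 1]) f x) Rif0.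
have ifabs : (\int[lebesgue]_(x in `[0%R, 1%R]) `|(EFin \o f) x| = 0)%E.
  rewrite -[RHS]if0; apply: eq_integral => x /[!inE] x01 /=.
  by rewrite ger0_norm// f0.
have [mf _] := integrableP _ _ _ intf.
have [N [mN N0 subN]] :=
  (ae_eq_integral_abs lebesgue (measurable_itv _) mf).1 ifabs.
pose Z : set R := [set 0; 1] `|` GRing.inv @` [set y | root p y].
have fZ : finite_set Z.
  by rewrite finite_setU; split; [exact: finite_set2|exact/finite_image/finite_roots].
have Z0 : lebesgue Z = 0%E by apply: countable_lebesgue_measure0; exact: finite_set_countable.
have mZ : measurable Z.
  by apply: countable_measurable => //; exact: finite_set_countable.
have sub : `[0, 1]%classic `<=` N `|` Z.
  move=> x x01; have [fx|fx] := eqVneq (f x) 0; last first.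
    by left; apply: subN => /= /(_ x01) [] /eqP; rewrite (negbTE fx).
  right; have [->|xn0] := eqVneq x 0; first by left; left.
  have [->|xn1] := eqVneq x 1; first by left; right.
  right; exists x^-1; last by rewrite invrK.
  move: x01; rewrite /= in_itv/= => /andP[x0 x1].
  move/eqP: fx; rewrite fE mulf_eq0 sqrf_eq0 /root => /orP[//|].
  by rewrite gt_eqF// inv_integrand_gt0// !lt_neqAle eq_sym xn0 x0 xn1.
have le01 : (lebesgue `[0%R, 1%R]%classic <= lebesgue (N `|` Z))%E.
  by apply: le_measure => //; rewrite inE; [exact: measurable_itv|exact: measurableU].
have := le_trans le01 (measureU2 _ mN mZ).
by rewrite lebesgue_measure_itv/= lte_fin ltr01 N0 Z0 adde0 oppr0 adde0 lee_fin ler10.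
Qed.

End MomentProperties.

(** * Passage from the moments in x to those in 1/x *)

Section HankelReversal.
Context {R : realType}.
Variables (a b : R) (k : nat).
Implicit Types t : R.
Hypothesis a0 : 0 < a.

Lemma moment_inv_moment t (i : nat) : (i <= 2 * k)%N ->
  moment a b t (2 * k - i) = inv_moment a (2 * k) b t i.
Proof.
move=> ik; apply: eq_Rintegral => x _; rewrite /inv_integrand /moment_integrand.
have [->|x0] := eqVneq x 0; first by rewrite powR0 ?gt_eqF// !(mulr0, mul0r).
by rewrite exprVn expfB_cond ?(negbTE x0)//; ring.
Qed.

(** Replacing i, j by k - i, k - j turns i + j into 2k - (i + j). Rows and columns undergo the same
    permutation, so the two signs cancel. *)
Lemma hankel_det_inv_moment t : hankel_det a b k.+1 t =
  \det (\matrix_(i < k.+1, j < k.+1) inv_moment a (2 * k) b t (i + j)%N).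
Proof.
rewrite /hankel_det; set A := \matrix_(_, _) _; set B := \matrix_(_, _) _.
pose s : {perm 'I_k.+1} := perm rev_ord_inj.
have -> : A = row_perm s (col_perm s B).
  apply/matrixP => i j; rewrite !mxE !permE/= -moment_inv_moment; last by lia.
  by congr moment; case: i j => [i ik] [j jk] /=; lia.
rewrite row_permE col_permE !det_mulmx !det_perm odd_permV mulrCA.
by rewrite -signr_addb addbb mulr1.
Qed.

End HankelReversal.

(** The second derivative occurs only on the left, and the two right-hand sides are the same
    polynomial in t, s and s', so the equivalence is a ring identity. *)
Lemma Htilde_ode_JMO (R : realType) (alpha beta : R) n (s : R -> R) t :
  Htilde_ode alpha beta n s t <->
  JMO_sigma_PV 0 (- (n%:R + alpha + beta)) n%:R (- beta) s t.
Proof.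
rewrite /Htilde_ode /JMO_sigma_PV /=.
by set l := (t * _) ^+ 2; split=> ->; ring.
Qed.

(** * The differential equation for n = k+1 *)

Section SigmaForm.
Context {R : realType}.
Variables (a b : R) (k : nat).
Implicit Types t : R.
Hypotheses (a0 : 0 < a) (b0 : 0 < b).
Local Notation N := (k.+1%:R : R).
Local Notation mu := (inv_moment a (2 * k) b).

Let mu_pos (t : R) : 0 < t -> forall p : {poly R}, p != 0 -> 0 < momfun (mu t) (p * p).
Proof. by move=> t0 p p0; exact: inv_moment_pos. Qed.

Let mu_derive (t : R) : 0 < t -> forall i,
  is_derive t 1 (fun u => mu u i) (- mu t i.+1).
Proof. by move=> t0 i; exact: inv_moment_derive. Qed.

Lemma hankel_detS_gt0 t : 0 < t -> 0 < hankel_det a b k.+1 t.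
Proof.
move=> t0; rewrite hankel_det_inv_moment// (det_hankel (mu_pos t0)).
by apply: prodr_gt0 => j _; exact: onorm_gt0 (mu_pos t0) j.
Qed.

Lemma is_derive_ln_hankel_detS t : 0 < t ->
  is_derive t 1 (fun u => ln (hankel_det a b k.+1 u)) (osub (mu t) k.+1).
Proof.
move=> t0; apply: gt0_near_eq_is_derive (is_derive_ln_hankel mu_pos mu_derive k.+1 t0) => //.
by move=> u u0; rewrite hankel_det_inv_moment.
Qed.

Lemma HtildeSE t : 0 < t ->
  Htilde a b k.+1 t = t * osub (mu t) k.+1 - N * (N + a + b).
Proof.
move=> t0; rewrite /Htilde /Hn derive1E.
by case: (is_derive_ln_hankel_detS t0) => _ ->.
Qed.

Lemma is_derive_HtildeS t : 0 < t -> is_derive t 1 (Htilde a b k.+1)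
  (osub (mu t) k.+1 + t * obeta (mu t) k).
Proof.
move=> t0; have h1 := is_deriveMf (is_derive_id t 1)
  (is_derive_osubS mu_pos mu_derive k t0).
have h2 := is_deriveB h1 (is_derive_cst (N * (N + a + b)) t 1).
apply: (gt0_near_eq_is_derive t0 _ (is_derive_eq h2 _)); last by rewrite mul1r subr0.
by move=> u u0; rewrite HtildeSE.
Qed.

Lemma is_derive_derive1_HtildeS t : 0 < t ->
  is_derive t 1 (derive1 (Htilde a b k.+1)) (2 * obeta (mu t) k
    + t * (obeta (mu t) k * (oalpha (mu t) k - oalpha (mu t) k.+1))).
Proof.
move=> t0; have h1 := is_deriveMf (is_derive_id t 1)
  (is_derive_obeta mu_pos mu_derive k t0).
have h2 := is_deriveD (is_derive_osubS mu_pos mu_derive k t0) h1.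
apply: (gt0_near_eq_is_derive t0 _ (is_derive_eq h2 _)); last by rewrite mul1r addrA -mulr2n mulr_natl.
by move=> u u0; rewrite derive1E; case: (is_derive_HtildeS u0).
Qed.

Lemma Htilde_odeS t : 0 < t -> Htilde_ode a b k.+1 (Htilde a b k.+1) t.
Proof.
move=> t0; rewrite /Htilde_ode/=.
rewrite !derive1E; case: (is_derive_derive1_HtildeS t0) => _ ->.
case: (is_derive_HtildeS t0) => _ ->; rewrite HtildeSE//.
(* Here g = a + 2k + b + 2, so the quantity g - 2n - b called [a] in [sigma_form] is the present
   [a]. *)
have := sigma_form (mu_pos t0) (inv_moment_pearson (2 * k) a0 b0 t0) k.
rewrite natrM -natr1 => ->.
ring.
Qed.

End SigmaForm.

Theorem mainTheorem4 (R : realType) (alpha beta : R) (n : nat)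
    (halpha : 0 < alpha) (hbeta : 0 < beta) :
  (* all the quantities are well defined: the integrals converge, the logarithm
     is that of a positive number, the derivatives exist *)
  (forall t : R, 0 < t ->
    [/\ forall k : nat, (@lebesgue_measure R).-integrable `[0, 1]
          (fun x => (moment_integrand alpha beta t k x)%:E),
        0 < hankel_det alpha beta n t,
        derivable (fun u : R => ln (hankel_det alpha beta n u)) t 1,
        derivable (Htilde alpha beta n) t 1
      & derivable (derive1 (Htilde alpha beta n)) t 1]) /\
  (* the differential equation *)
  (forall t : R, 0 < t -> Htilde_ode alpha beta n (Htilde alpha beta n) t) /\
  (* it is the sigma-form of Painleve V with the stated parameters *)
  (forall t : R, 0 < t ->
    JMO_sigma_PV 0 (- (n%:R + alpha + beta)) n%:R (- beta)
      (Htilde alpha beta n) t) /\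
  (forall (s : R -> R) (t : R),
    Htilde_ode alpha beta n s t <->
    JMO_sigma_PV 0 (- (n%:R + alpha + beta)) n%:R (- beta) s t).
Proof.
have hint t k : 0 < t -> (@lebesgue_measure R).-integrable `[0, 1]
    (fun x => (moment_integrand alpha beta t k x)%:E).
  (* The k-th moment integrand is [inv_integrand] with c = k and j = 0. *)
  move=> t0; have := inv_integrand_integrable k halpha 0 hbeta t0.
  by under [EFin \o _]eq_fun do rewrite /= /inv_integrand expr0 mul1r.
suff [h1 h2] : (forall t : R, 0 < t ->
    [/\ 0 < hankel_det alpha beta n t,
        derivable (fun u : R => ln (hankel_det alpha beta n u)) t 1,
        derivable (Htilde alpha beta n) t 1
      & derivable (derive1 (Htilde alpha beta n)) t 1]) /\
  (forall t : R, 0 < t -> Htilde_ode alpha beta n (Htilde alpha beta n) t).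
  split.
    by move=> t t0; have [? ? ? ?] := h1 t t0; split=> // k; exact: hint.
  split=> //; split; last by move=> s t; exact: Htilde_ode_JMO.
  by move=> t t0; apply/Htilde_ode_JMO; exact: h2.
(* The structure relations involve P_(n-1), so n = 0 is separate: D_0 = 1 makes [Htilde] identically
   0. *)
case: n => [|k].
  have det1 u : hankel_det alpha beta 0 u = 1 by rewrite /hankel_det det_mx00.
  have lnE : (fun u => ln (hankel_det alpha beta 0 u)) = cst 0.
    by apply/funext => u; rewrite det1 ln1.
  have HE : Htilde alpha beta 0 = cst 0.
    apply/funext => u; rewrite /Htilde /Hn lnE derive1_cst.
    by rewrite mulr0 mul0r subr0.
  have dHE : derive1 (Htilde alpha beta 0) = cst 0.
    by apply/funext => u; rewrite HE derive1_cst.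
  split=> t t0.
    rewrite det1 lnE dHE HE; split=> //; exact: derivable_cst.
  rewrite /Htilde_ode (_ : derive1n 2 _ = derive1 (derive1 (Htilde alpha beta 0)))//.
  by rewrite dHE derive1_cst HE /=; ring.
split=> t t0; last exact: Htilde_odeS.
have ? := is_derive_ln_hankel_detS k halpha hbeta t0.
have ? := is_derive_HtildeS k halpha hbeta t0.
have ? := is_derive_derive1_HtildeS k halpha hbeta t0.
by split; [exact: hankel_detS_gt0|exact: ex_derive..].
Qed.
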